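(* Let $\kappa$ and $\lambda$ be infinite cardinals, let $D$ be a uniform ultrafilter on $\kappa$, let ${\bf B}_i$ be a Boolean algebra for every $i<\kappa$, and let ${\bf B}=\prod_{i<\kappa}{\bf B}_i/D$ be the ultraproduct Boolean algebra. Assume: (a) $\lambda=\mathrm{cf}(\lambda)$; (b) $\lambda=\lambda^\kappa$; (c) $\mathrm{Depth}^+({\bf B}_i)\le\lambda$ for every $i<\kappa$. Then $\mathrm{Depth}^+({\bf B})\le\lambda^+$.
   Context: For a Boolean algebra ${\bf B}$, $\mathrm{Depth}({\bf B})=\sup\{\theta : \text{there is a strictly increasing sequence } (b_\gamma:\gamma<\theta) \text{ in } {\bf B}\}$, and $\mathrm{Depth}^+({\bf B})=\sup\{\theta^+ : \text{there is a strictly increasing sequence } (b_\gamma:\gamma<\theta) \text{ in } {\bf B}\}$. An ultrafilter $D$ on $\kappa$ is uniform if every member of $D$ has cardinality $\kappa$. *)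

(* Defs.v *)
From HB Require Import structures.
From mathcomp Require Import all_boot all_order.
From mathcomp Require Import generic_quotient.
From mathcomp Require Import mathcomp_extra boolp classical_sets functions.
From mathcomp Require Import cardinality filter wochoice.

Set Implicit Arguments.
Unset Strict Implicit.
Unset Printing Implicit Defensive.

Import Order.Theory.
Local Open Scope classical_set_scope.
Local Open Scope card_scope.

Lemma card_leTTP (T U : Type) :
  ([set: T] #<= [set: U]) <-> exists f : T -> U, injective f.
Proof.
split=> [/card_leP/injfunPex[f _ finj]|[f finj]].
  exists (fun x => val (f (SigSub (mem_set (I : [set: T] x))))) => x y /val_inj.
  by move=> /finj; rewrite !inE => /(_ I I) /(congr1 val).
have [g] : $|{injfun [set: T] >-> [set: U]}|.
  by apply/injfunPex; exists f => // x y _ _; exact: finj.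
exact: inj_card_le g.
Qed.

Lemma card_le_min (T : Type) (F : set (set T)) :
  F !=set0 -> exists2 A, F A & forall B, F B -> A #<= B.
Proof.
move=> [A0 FA0].
pose choosing (f : set T -> T) := forall A, F A -> A (f A).
pose P (X : set (set T -> T)) := X `<=` choosing /\
  forall f g A, X f -> X g -> F A -> f A = g A -> f = g.
have [|X [[Xch Xinj] Xmax]] := @Zorn_bigcup _ P.
  move=> C CP Ctot; split=> [f [X /CP[XX _] Xf]|f g A [X CX Xf] [Y CY Yg]].
    exact: XX.
  have [XY|YX] := Ctot _ _ CX CY.
    by apply: (CP _ CY).2 => //; exact: XY.
  by apply: (CP _ CX).2 => //; exact: YX.
have [[A FA AX]|noA] := pselect (exists2 A, F A & A `<=` [set f A | f in X]).
  exists A => // B FB.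
  apply: card_le_trans (subset_card_le AX) _.
  apply: card_le_trans (card_image_le _ _) _.
  have [g] : $|{injfun X >-> B}|.
    apply/injfunPex; exists (fun f => f B); first by move=> f /Xch/(_ B FB).
    by move=> f g; rewrite !inE => Xf Xg; exact: Xinj.
  exact: inj_card_le g.
have /choice[g gP] : forall A, exists a, F A -> A a /\ ~ [set f A | f in X] a.
  move=> A; have [FA|nFA] := pselect (F A); last first.
    have [[a _]|TT] := pselect ([set: T] !=set0); first by exists a.
    exfalso; apply: noA; exists A0 => // a; case: TT; by exists a.
  apply: contrapT => /forallNP h; apply: noA; exists A => // a Aa.
  by apply: contrapT => nXa; apply: (h a).
have nXg : ~ X g by move=> Xg; have [_] := gP _ FA0; apply; exists g.
exfalso; apply: (Xmax (X `|` [set g])).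
  by split=> [|/(_ g)/= h]; [exact: subsetUl|apply: nXg; apply: h; right].
split=> [f [/Xch//|->] A FA|f h A]; first by have [] := gP _ FA.
move=> [Xf|->] [Xh|->] FA //; first exact: Xinj FA.
  by move=> e; have [_ []] := gP _ FA; exists f.
by move=> e; have [_ []] := gP _ FA; exists h.
Qed.

Lemma card_le_comparable (T U : Type) :
  [set: T] #<= [set: U] \/ [set: U] #<= [set: T].
Proof.
pose F : set (set (T + U)) := [set range inl; range inr].
have eT : range (@inl T U) #= [set: T].
  by apply: inj_card_eq => x y _ _ [].
have eU : range (@inr T U) #= [set: U].
  by apply: inj_card_eq => x y _ _ [].
have [|A FA Amin] := @card_le_min _ F; first by exists (range inl); left.
have := Amin (range inl) (or_introl erefl).
have := Amin (range inr) (or_intror erefl).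
case: FA => ->; rewrite ?(card_le_eqr eT) ?(card_le_eqr eU) ?(card_le_eql eT)
  ?(card_le_eql eU) => h1 h2; by [left|right].
Qed.

Lemma card_le_Cantor (T : Type) : ~ ([set: set T] #<= [set: T]).
Proof.
move/card_leTTP => [f finj].
pose A : set T := [set x | exists2 B, f B = x & ~ B x].
have [Af|nAf] := pselect (A (f A)).
  by have [B /finj ->] := Af; apply.
by apply: (nAf); exists A.
Qed.

(* A cardinal is an initial ordinal: a well-order none of whose proper initial
   segments is equinumerous to the whole.  Two such structures of the same
   cardinality are order-isomorphic but not equal, so cardinals are compared
   with [ceq] rather than with Leibniz equality. *)
Record cardinal : Type := Cardinal {
  csort :> orderType Order.default_display ;
  cardinal_wo : well_order (<=%O : rel csort) ;
  cardinal_initial : forall x : csort,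
    ~ ([set: csort] #<= [set y : csort | (y < x)%O])
}.

Definition cle (k l : cardinal) : Prop := [set: k] #<= [set: l].
Definition clt (k l : cardinal) : Prop := cle k l /\ ~ cle l k.
Definition ceq (k l : cardinal) : Prop := [set: k] #= [set: l].

Lemma cardinal_exists (T : Type) : exists k : cardinal, [set: k] #= [set: T].
Proof.
have [R Rwo] := well_ordering_principle {classic T}.
have WF (A : set T) : A !=set0 -> exists2 x, A x & forall y, A y -> R x y.
  move=> [a Aa]; have [|z [[Az zmin] _]] := Rwo [pred x | `[< A x >]].
    by exists a; apply/asboolP.
  by exists z; [exact/asboolP|move=> y Ay; apply: zmin; apply/asboolP].
have Rwo' : {in <= predT, well_order R} by move=> A _; exact: Rwo.
have Rrefl : reflexive R by move=> x; exact: (wo_chain_reflexive Rwo').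
have Ranti : antisymmetric R.
  by move=> x y; apply: (wo_chain_antisymmetric Rwo').
have Rtot : total R by move=> x y; exact: (wo_chainW Rwo').
have Rtrans : transitive R.
  move=> y x z xy yz.
  have [|m mP mmin] := WF [set x; y; z]; first by exists x; left; left.
  have mx : R m x by apply: mmin; left; left.
  have my : R m y by apply: mmin; left; right.
  case: mP => [[]|] /= em; rewrite {m}em in mmin mx my.
  - by apply: mmin; right.
  - by have -> : x = y by apply: Ranti; rewrite xy mx.
  - have -> : z = y by apply: Ranti; rewrite my yz.
    by [].
pose seg x : set T := [set y | R y x /\ y <> x].
pose small x := ~ ([set: T] #<= seg x).
pose S := {x : {classic T} | `[< small x >]}.
pose RS : rel S := fun x y => R (val x) (val y).
have small_down x y : R y x -> small x -> small y.
  move=> yx sx sy; apply: sx; apply: card_le_trans sy _.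
  apply: subset_card_le => z [zy nzy]; split; first exact: Rtrans yx.
  by move=> zx; subst z; apply: nzy; apply: Ranti; rewrite zy yx.
have eS : [set: S] #= [set: T].
  apply: Cantor_Bernstein.
    by apply/card_leTTP; exists val; exact: val_inj.
  have [all|/existsNP[x0 nx0]] := pselect (forall x, small x).
    apply/card_leTTP; exists (fun x : T => (Sub (x : {classic T}) (introT (asboolP _) (all x)) : S)).
    by move=> x y [].
  have [|x nx xmin] := WF [set x | ~ small x]; first by exists x0.
  move/contrapT : (nx) => /card_le_trans; apply.
  have <- : range (val : S -> T) = seg x.
    apply/seteqP; split=> [_ [[y sy] _ <-]|y [yx nyx]] /=.
      move/asboolP : sy => sy; have := Rtot x y => /orP[xy|yx].
        by case: nx; exact: small_down xy sy.
      by split=> // e; apply: nx; rewrite -e.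
    have sy : small y.
      apply: contrapT => nsy; apply: nyx; apply: Ranti.
      by rewrite yx xmin.
    by exists (Sub (y : {classic T}) (introT (asboolP _) sy)).
  exact: card_image_le.
pose lt (x y : S) := (y != x) && RS x y.
have lt_def x y : lt x y = (y != x) && RS x y by [].
have RSanti : antisymmetric RS by move=> x y /Ranti/val_inj.
have RStrans : transitive RS by move=> y x z; exact: Rtrans.
have RStot : total RS by move=> x y; exact: Rtot.
pose SO : orderType Order.default_display := HB.pack S
  (@Order.isOrder.Build Order.default_display S RS lt
     (fun x y => if lt x y then x else y) (fun x y => if lt x y then y else x)
     lt_def (fun _ _ => erefl) (fun _ _ => erefl) RSanti RStrans RStot).
have SOwo : well_order (<=%O : rel SO).
  move=> A [a Aa].
  have [|x [s As sx] xmin] := WF (val @` [set s : S | A s]).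
    by exists (val a), a.
  exists s; split; first by split=> // t At; rewrite /Order.le /= /RS sx; apply: xmin; exists t.
  move=> t [At tmin]; apply: (RSanti s t); apply/andP; split; last exact: tmin.
  by rewrite /RS sx; apply: xmin; exists t.
have SOini (x : SO) : ~ ([set: SO] #<= [set y : SO | (y < x)%O]).
  rewrite (card_le_eql eS) => h.
  have /asboolP sx := valP (x : S); apply: sx; apply: card_le_trans h _.
  rewrite -(card_le_eql (@inj_card_eq _ _ _ (val : S -> T) _)); last first.
    by move=> ? ? _ _; exact: val_inj.
  apply: subset_card_le => _ [y yx <-].
  move: yx => /andP[nyx yx]; split => // e; case/eqP: nyx; exact/val_inj.
by exists (Cardinal SOwo SOini).
Qed.

Definition cardof (T : Type) : cardinal := projT1 (cid (cardinal_exists T)).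

Lemma cardofE (T : Type) : [set: cardof T] #= [set: T].
Proof. exact: projT2 (cid (cardinal_exists T)). Qed.

Definition is_least (P : cardinal -> Prop) (k : cardinal) : Prop :=
  P k /\ forall l, P l -> cle k l.

Lemma is_least_exists (P : cardinal -> Prop) : (exists k, P k) -> exists k, is_least P k.
Proof.
move=> [k0 Pk0].
pose F : set (set k0) := [set A | exists2 k, P k & A #= [set: k]].
have [|A [k Pk Ak] Amin] := @card_le_min _ F; first by exists setT, k0.
exists k; split=> // l Pl; rewrite /cle -(card_le_eql Ak).
have [/card_leTTP[f finj]|k0l] := card_le_comparable l k0; last first.
  exact: card_le_trans (card_leT A) k0l.
have el : range f #= [set: l] by apply: inj_card_eq => x y _ _; exact: finj.
by rewrite -(card_le_eqr el); apply: Amin; exists l.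
Qed.

(* The least member of a nonempty class of cardinals, and 0 otherwise. *)
Definition cmin (P : cardinal -> Prop) : cardinal :=
  if pselect (exists k, is_least P k) is left h then projT1 (cid h)
  else cardof void.

Lemma cminP (P : cardinal -> Prop) : (exists k, P k) -> is_least P (cmin P).
Proof.
rewrite /cmin => /is_least_exists Pk.
by case: pselect => // h; exact: projT2 (cid h).
Qed.

Definition csup (P : cardinal -> Prop) : cardinal :=
  cmin (fun k => forall l, P l -> cle l k).

Definition csucc (k : cardinal) : cardinal := cmin (clt k).

Definition cexp (l k : cardinal) : cardinal := cardof (k -> l).

Definition cf (l : cardinal) : cardinal :=
  cmin (fun k => exists2 A : set l,
    (forall x, exists2 y, A y & (x <= y)%O) & ceq k (cardof A)).

Definition cinfinite (k : cardinal) : Prop := infinite_set [set: k].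

Lemma csuccP (k : cardinal) : is_least (clt k) (csucc k).
Proof.
apply: cminP; exists (cardof (set k)); split; rewrite /cle.
  rewrite (card_le_eqr (cardofE _)).
  by apply/card_leTTP; exists set1 => x y /seteqP[/(_ x erefl)].
by rewrite (card_le_eql (cardofE _)); exact: card_le_Cantor.
Qed.

Lemma csupP (P : cardinal -> Prop) : (exists k, forall l, P l -> cle l k) ->
  is_least (fun k => forall l, P l -> cle l k) (csup P).
Proof. by move=> [k kP]; apply: cminP; exists k. Qed.

Lemma cfP (l : cardinal) : is_least (fun k => exists2 A : set l,
  (forall x, exists2 y, A y & (x <= y)%O) & ceq k (cardof A)) (cf l).
Proof.
apply: cminP; exists (cardof [set: l]), setT; last exact: card_eqxx.
by move=> x; exists x.
Qed.

Definition has_increasing_sequence d (B : porderType d) (t : cardinal) : Prop :=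
  exists b : t -> B, {homo b : x y / (x < y)%O}.

(* Lengths range over cardinals; allowing ordinal lengths, with successor
   |theta|^+, gives the same supremum, by restriction to |theta|. *)
Definition Depth_plus d (B : ctbDistrLatticeType d) : cardinal :=
  csup (fun k => exists2 t, has_increasing_sequence B t & k = csucc t).

Lemma Depth_plusP d (B : ctbDistrLatticeType d) :
  is_least (fun k => forall t, has_increasing_sequence B t -> cle (csucc t) k)
    (Depth_plus B).
Proof.
have [|ub lub] := csupP
    (P := fun k => exists2 t, has_increasing_sequence B t & k = csucc t).
  exists (csucc (cardof B)) => _ [t [b bhomo] ->].
  apply: (csuccP t).2; have [/= Bs nsB] := (csuccP (cardof B)).1.
  have tB : [set: t] #<= [set: cardof B].
    rewrite (card_le_eqr (cardofE B)); apply/card_leTTP; exists b => x y bxy.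
    by case: (ltgtP x y) => // /bhomo; rewrite bxy ltxx.
  split; first exact: card_le_trans tB Bs.
  by move=> st; apply: nsB; exact: card_le_trans st tB.
split=> [t tB|k kP]; first by apply: ub; exists t.
by apply: lub => _ [t tB ->]; exact: kP.
Qed.

Definition uniform (k : cardinal) (D : set_system k) : Prop :=
  forall A, D A -> A #= [set: k].

Section Ultraproduct.
Local Open Scope quotient_scope.
Variables (I : Type) (D : set_system I) (UD : UltraFilter D).
Variables (d : Order.disp_t) (B : I -> ctbDistrLatticeType d).

Definition upfun : Type := forall i, B i.
HB.instance Definition _ := gen_eqMixin upfun.
HB.instance Definition _ := gen_choiceMixin upfun.

Definition upeq : rel upfun := fun f g => `[< D [set i | f i = g i] >].

Lemma upeq_refl : reflexive upeq.
Proof. by move=> f; apply/asboolP; apply: filterS filterT. Qed.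

Lemma upeq_sym : symmetric upeq.
Proof.
by move=> f g; apply/asboolP/asboolP; apply: filterS => i /= ->.
Qed.

Lemma upeq_trans : transitive upeq.
Proof.
move=> g f h /asboolP fg /asboolP gh; apply/asboolP.
by apply: filterS2 fg gh => i /= -> ->.
Qed.

Canonical upeq_equiv := EquivRel upeq upeq_refl upeq_sym upeq_trans.

Definition ultraproduct : Type := {eq_quot upeq_equiv}.
HB.instance Definition _ : Choice ultraproduct :=
  Choice.copy ultraproduct {eq_quot upeq_equiv}.

Definition up_class (f : upfun) : ultraproduct := \pi_{eq_quot upeq_equiv} f.
Definition up_repr (x : ultraproduct) : upfun := repr x.

Lemma up_reprK : cancel up_repr up_class.
Proof. exact: reprK. Qed.

Lemma up_classP (f g : upfun) :
  up_class f = up_class g <-> D [set i | f i = g i].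
Proof. by split=> [/eqmodP/asboolP|h]; last exact/eqmodP/asboolP. Qed.

Lemma up_repr_class (f : upfun) : D [set i | up_repr (up_class f) i = f i].
Proof. by apply/up_classP; rewrite up_reprK. Qed.

Definition up_op1 (m : forall i, B i -> B i) (x : ultraproduct) :=
  up_class (fun i => m i (up_repr x i)).
Definition up_op2 (m : forall i, B i -> B i -> B i) (x y : ultraproduct) :=
  up_class (fun i => m i (up_repr x i) (up_repr y i)).

Lemma up_op1E m f : up_op1 m (up_class f) = up_class (fun i => m i (f i)).
Proof. by apply/up_classP; apply: filterS (up_repr_class f) => i /= ->. Qed.

Lemma up_op2E m f g :
  up_op2 m (up_class f) (up_class g) = up_class (fun i => m i (f i) (g i)).
Proof.
apply/up_classP; apply: filterS2 (up_repr_class f) (up_repr_class g).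
by move=> i /= -> ->.
Qed.

Lemma up_ind (P : ultraproduct -> Prop) :
  (forall f, P (up_class f)) -> forall x, P x.
Proof. by move=> Pc x; rewrite -(up_reprK x). Qed.

Let meet := up_op2 (fun i (x y : B i) => x `&` y)%O.
Let join := up_op2 (fun i (x y : B i) => x `|` y)%O.
Let compl := up_op1 (fun i (x : B i) => ~` x)%O.
Let bot : ultraproduct := up_class (fun i => \bot%O).
Let top : ultraproduct := up_class (fun i => \top%O).

Let le : rel ultraproduct := fun x y => meet x y == x.
Let lt : rel ultraproduct := fun x y => (y != x) && le x y.

Let up_ext (f g : upfun) : (forall i, f i = g i) -> up_class f = up_class g.
Proof. by move=> fg; apply/up_classP; apply: filterS filterT => i _. Qed.

Let up_meetC : commutative meet.
Proof.
elim/up_ind=> f; elim/up_ind=> g.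
by rewrite /meet !up_op2E; apply: up_ext => i; rewrite meetC.
Qed.
Let up_joinC : commutative join.
Proof.
elim/up_ind=> f; elim/up_ind=> g.
by rewrite /join !up_op2E; apply: up_ext => i; rewrite joinC.
Qed.
Let up_meetA : associative meet.
Proof.
elim/up_ind=> f; elim/up_ind=> g; elim/up_ind=> h.
by rewrite /meet !up_op2E; apply: up_ext => i; rewrite meetA.
Qed.
Let up_joinA : associative join.
Proof.
elim/up_ind=> f; elim/up_ind=> g; elim/up_ind=> h.
by rewrite /join !up_op2E; apply: up_ext => i; rewrite joinA.
Qed.
Let up_joinKI (y x : ultraproduct) : meet x (join x y) = x.
Proof.
elim/up_ind: y => g; elim/up_ind: x => f.
by rewrite /join /meet !up_op2E; apply: up_ext => i; rewrite joinKI.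
Qed.
Let up_meetKU (y x : ultraproduct) : join x (meet x y) = x.
Proof.
elim/up_ind: y => g; elim/up_ind: x => f.
by rewrite /join /meet !up_op2E; apply: up_ext => i; rewrite meetKU.
Qed.
Let up_meetUl : left_distributive meet join.
Proof.
elim/up_ind=> f; elim/up_ind=> g; elim/up_ind=> h.
by rewrite /join /meet !up_op2E; apply: up_ext => i; rewrite meetUl.
Qed.
Let up_meetxx : idempotent_op meet.
Proof.
elim/up_ind=> f.
by rewrite /meet !up_op2E; apply: up_ext => i; rewrite meetxx.
Qed.

HB.instance Definition _ :=
  @Order.isMeetJoinDistrLattice.Build d ultraproduct le lt meet join
    (fun _ _ => erefl) (fun _ _ => erefl) up_meetC up_joinC up_meetA up_joinA
    up_joinKI up_meetKU up_meetUl up_meetxx.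

Let up_le0x (x : ultraproduct) : (bot <= x)%O.
Proof.
elim/up_ind: x => f; apply/eqP.
by rewrite /meet /bot !up_op2E; apply: up_ext => i; rewrite meet0x.
Qed.
Let up_lex1 (x : ultraproduct) : (x <= top)%O.
Proof.
elim/up_ind: x => f; apply/eqP.
by rewrite /meet /top !up_op2E; apply: up_ext => i; rewrite meetx1.
Qed.

HB.instance Definition _ := Order.hasBottom.Build d ultraproduct up_le0x.
HB.instance Definition _ := Order.hasTop.Build d ultraproduct up_lex1.

Let up_joinxN (x : ultraproduct) : (x `|` compl x = \top)%O.
Proof.
elim/up_ind: x => f; rewrite /Order.join /= /join /compl up_op1E up_op2E.
by apply: up_ext => i; rewrite joinxC.
Qed.
Let up_meetxN (x : ultraproduct) : (x `&` compl x = \bot)%O.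
Proof.
elim/up_ind: x => f; rewrite /Order.meet /= /meet /compl up_op1E up_op2E.
by apply: up_ext => i; rewrite meetxC.
Qed.

HB.instance Definition _ :=
  Order.TBDistrLattice_hasComplement.Build d ultraproduct up_joinxN up_meetxN.

Lemma up_leP (f g : upfun) :
  (up_class f <= up_class g)%O <-> D [set i | (f i <= g i)%O].
Proof.
rewrite leEmeet; split=> [/eqP|fg]; last apply/eqP.
  rewrite /Order.meet /= /meet up_op2E => /up_classP.
  by apply: filterS => i /= fg; rewrite leEmeet; exact/eqP.
rewrite /Order.meet /= /meet up_op2E; apply/up_classP.
by apply: filterS fg => i /=; rewrite leEmeet => /eqP.
Qed.

End Ultraproduct.

(* Main.v *)
(* Proof by contradiction: let [f x], for [x < lambda^+], represent an increasing
   sequence modulo [D], and suppose that no [B i] has an increasing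
   [lambda]-sequence.  As [lambda^kappa = lambda], one can choose an increasing
   [g : lambda -> lambda^+] with the following reflection property: whenever
   [h : kappa -> lambda] is bounded by [e] and the diagonal function
   [i |-> f (g (h i)) i] is [D]-below some [f x], it is [D]-below [f (g e)].
   Let [delta] bound [g].  For each [i], the greedy increasing sequence in
   [X i = {f (g e) i | f (g e) i < f delta i}] has length less than [lambda],
   which gives a small subset of [X i] with no strict upper bound in [X i].
   Since [lambda] is regular and [kappa < lambda], all these subsets appear
   before a single stage [eps].  Selecting [h i < eps] in the [i]-th one with
   [f (g (h i)) i] not below [f (g eps) i] yields a function that is [D]-below
   [f delta], hence by reflection [D]-below [f (g eps)]: a contradiction. *)
Require Import Defs.
From mathcomp Require Import all_boot all_order.
From mathcomp Require Import boolp classical_sets functions cardinality filter.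

Set Implicit Arguments.
Unset Strict Implicit.
Unset Printing Implicit Defensive.

Import Order.Theory.
Local Open Scope classical_set_scope.
Local Open Scope card_scope.
Local Open Scope order_scope.

(** * Recursion and embeddings of initial ordinals *)

Lemma cardinal_min (k : cardinal) (A : set k) :
  A !=set0 -> exists2 x, A x & forall y, A y -> x <= y.
Proof.
move=> [a Aa]; have [|x [[/asboolP Ax xmin] _]] := @cardinal_wo k [pred x | `[< A x >]].
  by exists a; exact/asboolP.
by exists x => // y Ay; apply: xmin; exact/asboolP.
Qed.

Lemma cardinal_wf (k : cardinal) : well_founded (fun x y : k => x < y).
Proof.
move=> a; apply: contrapT => na.
have [|x nx xmin] := @cardinal_min k [set x | ~ Acc (fun x y : k => x < y) x].
  by exists a.
apply: nx; constructor=> y yx; apply: contrapT => ny.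
by have := xmin _ ny; rewrite leNgt yx.
Qed.

(** Nonemptiness is asked only at the stage considered, so that a greedy construction is allowed to
    stall; [u0] is the value at a stalled stage. *)
Lemma cardinal_recursion (k : cardinal) (U : Type) (u0 : U) (P : set U -> set U) :
  exists u : k -> U, forall x,
    let S := u @` [set y | y < x] in P S !=set0 -> P S (u x).
Proof.
pose pick S := if pselect (P S !=set0) is left h then projT1 (cid h) else u0.
pose F x (r : forall y : k, y < x -> U) := pick [set v | exists y h, r y h = v].
exists (Fix (@cardinal_wf k) (fun=> U) F) => x /=.
rewrite [Fix _ _ _ x]Fix_eq; last first.
  move=> {}x f g fg; congr pick; apply/seteqP.
  by split=> v [y [h <-]]; exists y, h.
rewrite {3}/F; set S1 := image _ _; set S2 := [set v | _].
have -> : S2 = S1.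
  by apply/seteqP; split=> v [y] => [[h <-]|h <-]; [exists y|exists y, h].
by rewrite /pick => PS; case: pselect => // h; exact: projT2 (cid h).
Qed.

(** Sending [x] to the least value not yet taken never stalls: otherwise [l] would be the image of a
    proper initial segment of [k], against [cardinal_initial]. *)
Lemma cle_embedding (k l : cardinal) :
  cle k l -> exists u : k -> l, {homo u : x y / x < y}.
Proof.
move=> kl; have [k0|k0] := pselect ([set: k] !=set0); last first.
  have f (x : k) : l by case: k0; exists x.
  by exists f => x; case: k0; exists x.
have [f _] := iffLR (card_leTTP _ _) kl; have [x0 _] := k0.
have [u uP] := cardinal_recursion k (f x0)
  (fun S => [set z | ~ S z /\ forall w, ~ S w -> z <= w]).
have {}uP x := uP x.
have uS x : ~ (u @` [set y | y < x]) (u x) /\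
    forall w, ~ (u @` [set y | y < x]) w -> u x <= w.
  apply: uP; have [|z nz zmin] := @cardinal_min l (~` (u @` [set y | y < x])).
    apply: contrapT => /set0P/negP/negPn/eqP/(congr1 setC).
    rewrite setCK setC0 => ul; apply: (@cardinal_initial k x).
    apply: card_le_trans kl _; rewrite -ul; exact: card_image_le.
  by exists z.
exists u => x y xy; rewrite lt_neqAle; apply/andP; split.
  by apply/eqP => e; apply: (uS y).1; exists x.
apply: (uS x).2 => -[z zx e]; apply: (uS y).1; exists z => //.
exact: lt_trans zx xy.
Qed.

Lemma csucc_embedding (k t : cardinal) :
  ~ cle t k -> exists u : csucc k -> t, {homo u : x y / x < y}.
Proof.
move=> tk; apply: cle_embedding; apply: (csuccP k).2; split=> //.
by case: (card_le_comparable t k).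
Qed.

(** * Bounded sets in regular and successor cardinals *)

Lemma regular_bounded (l : cardinal) (S : set l) : ceq l (cf l) ->
  ~ ([set: l] #<= S) -> exists b, forall s, S s -> s < b.
Proof.
move=> lreg lS; apply: contrapT => /forallNP nb; apply: lS.
rewrite (card_le_eql lreg).
have Scof : cle (cf l) (cardof S).
  apply: (cfP l).2; exists S; last exact: card_eqxx.
  move=> x; have /existsNP[s /not_implyP[Ss /negP]] := nb x.
  by rewrite -leNgt => xs; exists s.
apply: card_le_trans Scof _; rewrite (card_le_eql (cardofE _)).
by rewrite (card_le_eql (card_setT _)).
Qed.

Lemma segment_csucc_le (k : cardinal) (z : csucc k) :
  [set y : csucc k | y < z] #<= [set: k].
Proof.
set S := [set y | _]; apply: contrapT => Sk; apply: (@cardinal_initial _ z).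
have eS : [set: cardof S] #= S.
  exact: card_eq_trans (cardofE _) (card_setT _).
rewrite -(card_le_eqr eS); apply: (csuccP k).2; split; rewrite /cle.
  have [] := card_le_comparable k (cardof S) => //.
  by rewrite (card_le_eql eS).
by rewrite (card_le_eql eS).
Qed.

Lemma infinite_two_points (T : Type) :
  infinite_set [set: T] -> exists x y : T, y <> x.
Proof.
move=> Tinf; have [x _] := infinite_setN0 Tinf; exists x.
apply: contrapT => /forallNP nx; apply: Tinf.
apply: (@sub_finite_set _ _ [set x]); last exact: finite_set1.
by move=> y _; apply: contrapT; exact: nx.
Qed.

(** If the range were unbounded, each [x] would be at or below some [G t], which has at most [k]
    predecessors; coding [x] by [t] and its place there would inject [csucc k] into [k]. *)
Lemma csucc_bounded (k : cardinal) (T : Type) (G : T -> csucc k) :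
  cinfinite k -> (exists p : k * k -> k, injective p) ->
  [set: T] #<= [set: k] -> exists b, forall t, G t < b.
Proof.
move=> kinf [p pinj] /card_leTTP[j jinj].
apply: contrapT => /forallNP nb; apply: (csuccP k).1.2; apply/card_leTTP.
have [e0 [e1 e10]] := infinite_two_points kinf.
have /choice[t tP] x : exists t, x <= G t.
  by have /existsNP[t /negP] := nb x; rewrite -leNgt => xt; exists t.
have /choice[phi phiP] (z : csucc k) : exists f : csucc k -> k,
    forall x y, x < z -> y < z -> f x = f y -> x = y.
  have := segment_csucc_le z; rewrite -(card_le_eql (card_setT _)).
  move=> /card_leTTP[f finj].
  exists (fun y => if pselect (y < z) is left h then f (SigSub (mem_set (h : [set y | y < z] y))) else e0).
  move=> x y xz yz; case: pselect => // xz'; case: pselect => // yz'.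
  by move=> /finj[].
(* Since [phi z] is known to be injective only strictly below [z], the last entry records whether
   [x] equals [G (t x)]. *)
exists (fun x => p (j (t x), p (phi (G (t x)) x, if x == G (t x) then e1 else e0))).
move=> x y /pinj[/jinj txy /pinj[]]; rewrite txy => phixy exy.
have := tP y; have := tP x; rewrite txy !le_eqVlt.
case: (x =P G (t y)) exy => [->|_]; case: (y =P G (t y)) => [<-|_] //=.
  by move/esym/e10.
by move=> _ xlt ylt; exact: phiP phixy.
Qed.

(* The set [S] is the range of a greedy increasing sequence in [X]. *)
Lemma small_unbounded_subset (l : cardinal) d (B : porderType d) (b0 : B) (X : set B) :
  ~ has_increasing_sequence B l ->
  exists S : set B, [/\ ~ ([set: l] #<= S), S `<=` X &
    forall b, X b -> exists2 s, S s & ~~ (s < b)].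
Proof.
move=> nB.
pose P (S : set B) := [set b | X b /\ forall s, S s -> s < b].
have [u uP] := cardinal_recursion l b0 P.
have [h|/existsNP[x0 nx0]] := pselect (forall x, P (u @` [set y | y < x]) !=set0).
  case: nB; exists u => x y xy; have [_] := uP _ (h y); apply.
  by exists x.
have [|x nx xmin] := @cardinal_min l [set x | ~ (P (u @` [set y | y < x]) !=set0)].
  by exists x0.
exists (u @` [set y | y < x]); split.
- move=> lS; apply: (@cardinal_initial l x).
  apply: card_le_trans lS _; exact: card_image_le.
- move=> _ [y yx <-]; have [|//] := uP y _.
  by apply: contrapT => /xmin; rewrite leNgt yx.
move=> b Xb; apply: contrapT => nS; apply: nx; exists b; split=> // s Ss.
by apply: contrapT => /negP sb; apply: nS; exists s.
Qed.

(** A pair is coded by the function on [k] with its first entry at [k0] and its second elsewhere. *)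
Lemma inj_pair_of_exp (k l : cardinal) : cinfinite k -> cle (cexp l k) l ->
  exists p : l * l -> l, injective p.
Proof.
move=> kinf; rewrite /cle (card_le_eql (cardofE _)) => /card_leTTP[f finj].
have [k0 [k1 k10]] := infinite_two_points kinf.
exists (fun ab => f (fun i => if i == k0 then ab.1 else ab.2)).
move=> [a b] [a' b'] /finj /= e; congr pair.
  by have := congr1 (@^~ k0) e; rewrite /= eqxx.
by have := congr1 (@^~ k1) e; rewrite /=; case: eqP.
Qed.

(** Otherwise [2^k <= l^k <= l <= k], against Cantor. *)
Lemma exp_exponent_lt (k l : cardinal) : cinfinite l -> cle (cexp l k) l -> ~ cle l k.
Proof.
move=> linf; rewrite /cle (card_le_eql (cardofE _)) => lkl lk.
apply: (@card_le_Cantor k); apply: card_le_trans (card_le_trans lkl lk).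
have [e0 [e1 e10]] := infinite_two_points linf.
apply/card_leTTP; exists (fun A i => if `[< A i >] then e1 else e0) => A A' e.
apply/seteqP; split=> i Ai; have := congr1 (@^~ i) e => /=.
  by rewrite asboolT //; case: asboolP => // _ /e10.
by rewrite [in RHS]asboolT //; case: asboolP => // _ /esym/e10.
Qed.

(** * Reflection modulo a filter *)

Lemma increasing_mod_filter (k l : cardinal) (D : set_system k) (PD : ProperFilter D)
    d (B : k -> bPOrderType d) (f : csucc l -> forall i, B i) :
  cinfinite k -> cinfinite l -> ceq l (cf l) -> cle (cexp l k) l ->
  (forall x y, x < y -> D [set i | f x i < f y i]) ->
  exists i, has_increasing_sequence (B i) l.
Proof.
move=> kinf linf lreg lkl fhomo; apply: contrapT => /forallNP nB.
have pairs := inj_pair_of_exp kinf lkl.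
have lk := exp_exponent_lt linf lkl.
have lkl' : [set: k -> l] #<= [set: l] by rewrite -(card_le_eql (cardofE _)).
have [e0 _] := infinite_setN0 linf.
have [z0 _] : [set: csucc l] !=set0.
  have [_] := (csuccP l).1; apply: contra_notP => /forallNP n.
  by apply/card_leTTP; exists (fun=> e0) => x; case: (n x).
have bounded := fun T G => @csucc_bounded l T G linf pairs.
have /choice[w wP] (h : k -> csucc l) : exists z,
    (exists x, D [set i | f (h i) i < f x i]) -> D [set i | f (h i) i < f z i].
  have [[x hx]|nx] := pselect (exists x, D [set i | f (h i) i < f x i]).
    by exists x.
  by exists z0.
(* Exceeding [w h] for every [h] into the earlier values is what yields reflection. *)
pose P (G : set (csucc l)) := [set z | (forall y, G y -> y < z) /\
  forall h, (forall i, G (h i)) -> w h < z].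
have PN0 G : G #<= [set: l] -> P G !=set0.
  rewrite -(card_le_eql (card_setT _)) => Gl.
  have [b1 b1P] := bounded _ (fun y : set_type G => val y) Gl.
  (* There are at most [l^k <= l] such [h], so one bound serves them all. *)
  have [|b2 b2P] := bounded (k -> set_type G) (fun h => w (fun i => val (h i))).
    apply: card_le_trans lkl'; have [j jinj] := iffLR (card_leTTP _ _) Gl.
    apply/card_leTTP; exists (fun h i => j (h i)) => h h' e; apply: funext => i.
    by apply: jinj; exact: (congr1 (@^~ i) e).
  exists (Order.max b1 b2); split=> [y Gy|h Gh]; rewrite lt_max.
    by rewrite (b1P (SigSub (mem_set Gy))).
  by rewrite (b2P (fun i => SigSub (mem_set (Gh i)))) orbT.
have [g gP] := cardinal_recursion l z0 P.
have {}gP x : P (g @` [set y | y < x]) (g x).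
  apply: gP; apply: PN0; apply: card_le_trans (card_image_le _ _) _.
  exact: card_leT.
have [delta deltaP] := bounded l g (card_lexx _).
pose X i := [set f (g e) i | e in [set e | f (g e) i < f delta i]].
(* Pulls values in [X i] back to indices in [l], where regularity applies. *)
have rex i : exists r : B i -> l, forall b, X i b -> f (g (r b)) i = b.
  have /choice[r rP] b : exists e, X i b -> f (g e) i = b.
    have [[e _ <-]|nX] := pselect (X i b); first by exists e.
    by exists e0.
  by exists r.
have [r rP] := all_tag (fun i => cid (rex i)).
have [S SP] :=
  all_tag (fun i => cid (small_unbounded_subset \bot (X i) (nB i))).
have /choice[beta betaP] i : exists b, forall s, S i s -> r i s < b.
  have [|b bP] := @regular_bounded l (r i @` S i) lreg.
    have [lS _ _] := SP i; apply: contra_not lS => /card_le_trans; apply.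
    exact: card_image_le.
  by exists b => s Ss; apply: bP; exists s.
have [|eps epsP] := @regular_bounded l (range beta) lreg.
  apply: contra_not lk => /card_le_trans; apply; exact: card_image_le.
have {}epsP i : beta i < eps by apply: epsP; exists i.
have /choice[h hP] i : exists z, z < eps /\ (f (g eps) i < f delta i ->
    f (g z) i < f delta i /\ ~~ (f (g z) i < f (g eps) i)).
  have [lt_eps|nlt_eps] := pselect (f (g eps) i < f delta i); last first.
    (* Such [i] lie outside a set of [D], so any value below [eps] will do. *)
    by exists (beta i); split=> // /nlt_eps.
  have [_ SX Sunb] := SP i; have [|s Ss sN] := Sunb (f (g eps) i); first by exists eps.
  have Xs := SX _ Ss; exists (r i s); rewrite (rP _ _ Xs).
  split=> [|_]; first exact: lt_trans (betaP _ _ Ss) (epsP i).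
  by split=> //; have [e /= he <-] := Xs.
have Deps := fhomo _ _ (deltaP eps).
have Dh : D [set i | f (g (h i)) i < f delta i].
  by apply: filterS Deps => i /= /(hP i).2[].
have [_ gw] := gP eps.
have wlt : w (g \o h) < g eps by apply: gw => i; exists (h i) => //; exact: (hP i).1.
have Dw : D [set i | f (g (h i)) i < f (w (g \o h)) i].
  by apply: (wP (g \o h)); exists delta.
have [i [[/= hw weps] /(hP i).2[_ /negP]]] :=
  filter_ex (filterI (filterI Dw (fhomo _ _ wlt)) Deps).
by apply; exact: lt_trans hw weps.
Qed.

(** * Depth of the ultraproduct *)

Lemma up_lt (I : Type) (D : set_system I) (UD : UltraFilter D) d
    (B : I -> ctbDistrLatticeType d) (x y : ultraproduct UD B) :
  x < y -> D [set i | up_repr x i < up_repr y i].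
Proof.
rewrite lt_leAnge -{1 2}(up_reprK x) -{1 2}(up_reprK y) => /andP[/up_leP xy /negP yx].
have [/up_leP//|nyx] := in_ultra_setVsetC [set i | up_repr y i <= up_repr x i] UD.
by apply: filterS2 xy nyx => i /= xyi /negP yxi; rewrite lt_leAnge xyi.
Qed.

Theorem theorem2p4 (kappa lambda : cardinal)
  (kappa_inf : cinfinite kappa) (lambda_inf : cinfinite lambda)
  (D : set_system kappa) (UD : UltraFilter D) (D_unif : uniform D)
  (d : Order.disp_t) (B : kappa -> ctbDistrLatticeType d)
  (lambda_reg : ceq lambda (cf lambda))
  (lambda_pow : ceq lambda (cexp lambda kappa))
  (B_depth : forall i : kappa, cle (Depth_plus (B i)) lambda) :
  cle (Depth_plus (ultraproduct UD B)) (csucc lambda).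
Proof.
apply: (Depth_plusP _).2 => t [b bhomo].
have [tl|tl] := pselect (cle t lambda).
  have [lS nSl] := (csuccP lambda).1.
  apply: (csuccP t).2; split; first exact: card_le_trans tl lS.
  by apply: contra_not nSl => /card_le_trans; apply.
(* A sequence longer than [lambda] contains one of length [csucc lambda]. *)
have [u uhomo] := csucc_embedding tl.
have [||i /(Depth_plusP _).1 succ_le] := @increasing_mod_filter kappa lambda D _ d B
    (fun x => up_repr (b (u x))) kappa_inf lambda_inf lambda_reg.
- by move: lambda_pow; rewrite /ceq card_eq_le => /andP[].
- by move=> x y xy; apply: up_lt; apply: bhomo; exact: uhomo.
(* This would give [csucc lambda <= Depth_plus (B i) <= lambda]. *)
have [_ []] := (csuccP lambda).1; exact: card_le_trans succ_le (B_depth i).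
Qed.
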